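(* Let $a,b,\lambda,q\in\mathbb{C}$ with $|q|<1$. Then $$\frac{G(a,b,\lambda)}{G(aq,b,\lambda q)}=1+aq+\cfrac{\lambda q-abq^2}{1+aq^2+\cfrac{bq+\lambda q^2}{1+aq^3+\cfrac{\lambda q^3-abq^5}{1+aq^4+\cfrac{bq^2+\lambda q^4}{1+aq^5+\cfrac{\lambda q^5-abq^8}{1+aq^6+\cfrac{bq^3+\lambda q^6}{1+aq^7+\cdots}}}}}},$$ i.e. the left side equals $b_0+K_{k\ge1}(a_k/b_k)$ with $b_k=1+aq^{k+1}$ for $k\ge0$, and $a_{2n-1}=\lambda q^{2n-1}-abq^{3n-1}$, $a_{2n}=bq^n+\lambda q^{2n}$ for $n\ge1$.
   Context: For complex $a,b,\lambda,q$ with $|q|<1$, $$G(a,b,\lambda):=\sum_{n\ge0}\frac{q^{(n^2+n)/2}(a+\lambda)(a+\lambda q)\cdots(a+\lambda q^{n-1})}{(1-q)\cdots(1-q^n)\,(1+bq)\cdots(1+bq^n)}.$$ For complex sequences $(a_k)_{k\ge1}$ with all $a_k\neq0$ and $(b_k)_{k\ge0}$, the continued fraction $b_0+K_{k\ge1}(a_k/b_k)=b_0+\cfrac{a_1}{b_1+\cfrac{a_2}{b_2+\cdots}}$ has value $f\in\mathbb{C}\cup\{\infty\}$ if its approximants $b_0+\cfrac{a_1}{b_1+\cdots+\cfrac{a_n}{b_n}}$ converge to $f$ as $n\to\infty$. The parameters are assumed to be such that both sides make sense: $1+bq^n\neq0$ for all $n\ge1$, $G(aq,b,\lambda q)\ne0$,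 and all partial numerators $a_k$ are nonzero. *)

(* Defs.v *)
From Stdlib Require Import Reals Arith.
From Coquelicot Require Import Coquelicot.

Open Scope C_scope.

Fixpoint Cprod (f : nat -> C) (n : nat) : C :=
  match n with
  | O => 1
  | S m => Cprod f m * f m
  end.

(** Unspecified when the series diverges, like Coquelicot's [Series]. *)
Definition CSeries (u : nat -> C) : C :=
  iota (T := C_CompleteNormedModule)
       (fun s => is_series (V := C_NormedModule) u s).

Definition G_term (q a b lam : C) (n : nat) : C :=
  q ^ ((n ^ 2 + n) / 2) * Cprod (fun j => a + lam * q ^ j) n
  / (Cprod (fun j => 1 - q ^ S j) n * Cprod (fun j => 1 + b * q ^ S j) n).

Definition G (q a b lam : C) : C := CSeries (G_term q a b lam).

(** The Riemann sphere; [None] is the point at infinity. *)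
Definition Chat : Type := option C.

(** Intended for [a <> 0], where [a / 0] is infinity and [a / infinity] is 0. *)
Definition Chat_div (a : C) (w : Chat) : Chat :=
  match w with
  | None => Some (RtoC 0)
  | Some z => if Ceq_dec z 0 then None else Some (a / z)
  end.

Definition Chat_plus (b : C) (w : Chat) : Chat :=
  match w with
  | None => None
  | Some z => Some (b + z)
  end.

Definition Chat_locally (l : Chat) (P : Chat -> Prop) : Prop :=
  match l with
  | Some z => locally z (fun w => P (Some w))
  | None => P None /\ exists M : R, forall w : C, (M < Cmod w)%R -> P (Some w)
  end.

(** [cf_from num den k n] is
    [den k + num (k+1) / (den (k+1) + ... + num (k+n) / den (k+n))],
    evaluated on the Riemann sphere, so that vanishing intermediate
    denominators are allowed. *)
Fixpoint cf_from (num den : nat -> C) (k n : nat) : Chat :=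
  match n with
  | O => Some (den k)
  | S m => Chat_plus (den k)
             (Chat_div (num (S k)) (cf_from num den (S k) m))
  end.

Definition cf_approximant (num den : nat -> C) (n : nat) : Chat :=
  cf_from num den 0 n.

(** The value [num 0] is irrelevant. *)
Definition cf_has_value (num den : nat -> C) (f : Chat) : Prop :=
  filterlim (cf_approximant num den) eventually (Chat_locally f).

(** For [k = 2 n - 1] and for [k = 2 n], [(k + 1) / 2] is [n]. *)
Definition partial_num (q a b lam : C) (k : nat) : C :=
  let n := ((k + 1) / 2)%nat in
  if Nat.odd k then lam * q ^ (2 * n - 1) - a * b * q ^ (3 * n - 1)
  else b * q ^ n + lam * q ^ (2 * n).

Definition partial_den (q a : C) (k : nat) : C := 1 + a * q ^ (k + 1).

(* Main.v *)
(** Put [F_(2k) = G(a q^(2k), b q^k, lam q^(2k)) / ((1 + bq) ... (1 + b q^k))]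
    and [F_(2k+1) = G(a q^(2k+1), b q^k, lam q^(2k+1)) / ((1 + bq) ... (1 + b q^k))].
    Comparing series term by term, the difference telescopes and yields
    [F_m = b_m F_(m+1) + a_(m+1) F_(m+2)].  Hence the approximants [A_n / B_n]
    satisfy [F_0 = A_n F_(n+1) + a_(n+1) A_(n-1) F_(n+2)] and
    [F_1 = B_n F_(n+1) + a_(n+1) B_(n-1) F_(n+2)].  Since [a_n] and [b_n - 1]
    decay geometrically, the [A_n] and [B_n] are bounded, and so are the [F_m];
    therefore [A_n F_(n+1)] tends to [F_0], [B_n F_(n+1)] to [F_1], and their
    quotient to [F_0 / F_1]. *)

Require Import Defs.
From Stdlib Require Import Reals Arith Lia Lra FunctionalExtensionality.
From Coquelicot Require Import Coquelicot.
Open Scope C_scope.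

(** * Continuants and approximants on the Riemann sphere *)

(** Euler's continuants with [n] denominators starting at index [k], expanded from the front to
    match [cf_from]. In the notation [A_n / B_n] for approximants, [A_n] is
    [continuant num den 0 (S n)] and [B_n] is [continuant num den 1 n]. *)
Fixpoint continuant (num den : nat -> C) (k n : nat) : C :=
  match n with
  | O => 1
  | S O => den k
  | S (S m as p) =>
      den k * continuant num den (S k) p
      + num (S k) * continuant num den (S (S k)) m
  end.

Lemma continuant_SS (num den : nat -> C) k n :
  continuant num den k (S (S n))
  = den k * continuant num den (S k) (S n)
    + num (S k) * continuant num den (S (S k)) n.
Proof. reflexivity. Qed.

(** Excludes 0/0 in an approximant. If both vanished, nonzero partial numerators would pass the
    vanishing on to shorter continuants, down to the empty one, which is 1. *)
Lemma continuant_consecutive (num den : nat -> C) k n :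
  (forall j, num (S j) <> 0) ->
  continuant num den (S k) n = 0 -> continuant num den k (S n) <> 0.
Proof.
  intros Hnum; revert k; induction n as [|n IH]; intros k H0 H1.
  - apply C1_nz, H0.
  - rewrite continuant_SS, H0, Cmult_0_r, Cplus_0_l in H1.
    destruct (Ceq_dec (continuant num den (S (S k)) n) 0) as [E|E].
    + exact (IH (S k) E H0).
    + exact (Cmult_neq_0 _ _ (Hnum k) E H1).
Qed.

Lemma cf_from_continuant (num den : nat -> C) k n :
  (forall j, num (S j) <> 0) ->
  cf_from num den k n =
  if Ceq_dec (continuant num den (S k) n) 0 then None
  else Some (continuant num den k (S n) / continuant num den (S k) n).
Proof.
  intros Hnum; revert k; induction n as [|n IH]; intros k.
  - simpl. destruct (Ceq_dec 1 0) as [E|E]; [now destruct C1_nz|].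
    f_equal; field; exact C1_nz.
  - simpl cf_from; rewrite IH.
    pose proof (continuant_consecutive num den (S k) n Hnum) as Hc.
    rewrite (continuant_SS num den k n).
    destruct (Ceq_dec (continuant num den (S (S k)) n) 0) as [E|E];
      destruct (Ceq_dec (continuant num den (S k) (S n)) 0) as [E'|E'];
      cbn [Chat_div Chat_plus].
    (* The remaining cases: an infinite tail contributes 0, a zero tail gives infinity, and any
       other tail is inverted as a complex number. *)
    + now destruct (Hc E).
    + rewrite E; f_equal; field; exact E'.
    + destruct Ceq_dec as [_|N]; [reflexivity|].
      destruct N; rewrite E'; unfold Cdiv; ring.
    + destruct Ceq_dec as [Z|_].
      * destruct E'.
        transitivity (continuant num den (S k) (S n)
                      / continuant num den (S (S k)) n
                      * continuant num den (S (S k)) n);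
          [field; exact E | rewrite Z; ring].
      * cbn [Chat_plus]; f_equal; field; now split.
Qed.

(** Expand [F k] once and apply the claim to [F (S k)] and [F (S (S k))] with lengths shorter by one
    and by two: both expansions end at the same index, so the continuant recurrence recombines
    them. *)
Lemma continuant_recurrence (num den : nat -> C) (F : nat -> C) k n :
  (forall j, F j = den j * F (S j) + num (S j) * F (S (S j))) ->
  F k = continuant num den k (S n) * F (S (k + n))
        + num (S (k + n)) * continuant num den k n * F (S (S (k + n))).
Proof.
  intros HF.
  enough (H : forall m j, (m <= n)%nat ->
    F j = continuant num den j (S m) * F (S (j + m))
        + num (S (j + m)) * continuant num den j m * F (S (S (j + m))))
    by now apply H.
  induction m as [m IH] using lt_wf_ind; intros j Hm.
  destruct m as [|[|m]].
  - simpl; rewrite Nat.add_0_r, (HF j); ring.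
  - simpl; rewrite Nat.add_1_r, (HF j), (HF (S j)); ring.
  - rewrite (HF j), (IH (S m) ltac:(lia) (S j) ltac:(lia)),
      (IH m ltac:(lia) (S (S j)) ltac:(lia)).
    rewrite (continuant_SS num den j (S m)), (continuant_SS num den j m).
    replace (S j + S m)%nat with (j + S (S m))%nat by lia.
    replace (S (S j) + m)%nat with (j + S (S m))%nat by lia.
    ring.
Qed.

(** * Uniform bounds for continuants *)

(** The weight [exp (c x^k / (1 - x))] is the exact supersolution of the
    recursion bounding the continuants. *)
Lemma exp_geom_step c x k :
  (0 <= c)%R -> (0 < x < 1)%R ->
  ((1 + c * x ^ k) * exp (c * x ^ S k / (1 - x)) <= exp (c * x ^ k / (1 - x)))%R.
Proof.
  intros Hc Hx.
  replace (c * x ^ k / (1 - x))%R with (c * x ^ k + c * x ^ S k / (1 - x))%R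
    by (simpl; field; lra).
  rewrite exp_plus.
  apply Rmult_le_compat_r; [apply Rlt_le, exp_pos | apply exp_ineq1_le].
Qed.

Lemma exp_geom_decr c x k n :
  (0 <= c)%R -> (0 < x < 1)%R ->
  (exp (c * x ^ (k + n) / (1 - x)) <= exp (c * x ^ k / (1 - x)))%R.
Proof.
  intros Hc Hx; induction n as [|n IH].
  - rewrite Nat.add_0_r; lra.
  - rewrite Nat.add_succ_r; eapply Rle_trans; [|exact IH].
    pose proof (exp_geom_step c x (k + n) Hc Hx) as H.
    pose proof (exp_pos (c * x ^ S (k + n) / (1 - x))) as H1.
    assert (H2 : (0 <= c * x ^ (k + n))%R)
      by (apply Rmult_le_pos; [exact Hc | apply pow_le; lra]).
    nra.
Qed.

Lemma continuant_bound (num den : nat -> C) c x k n :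
  (0 <= c)%R -> (0 < x < 1)%R ->
  (forall j, (Cmod (den j) + Cmod (num (S j)) <= 1 + c * x ^ j)%R) ->
  (Cmod (continuant num den k n) <= exp (c * x ^ k / (1 - x)))%R.
Proof.
  intros Hc Hx H.
  enough (Hm : forall m j, (m <= n)%nat ->
    (Cmod (continuant num den j m) <= exp (c * x ^ j / (1 - x)))%R)
    by now apply Hm.
  induction m as [m IH] using lt_wf_ind; intros j Hm.
  pose proof (exp_geom_step c x j Hc Hx) as H1.
  pose proof (exp_geom_decr c x (S j) 1 Hc Hx) as H2.
  rewrite Nat.add_1_r in H2.
  assert (Hj : (0 <= c * x ^ j)%R)
    by (apply Rmult_le_pos; [exact Hc | apply pow_le; lra]).
  assert (Hj' : (1 <= exp (c * x ^ S j / (1 - x)))%R).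
  { eapply Rle_trans; [|apply exp_ineq1_le].
    enough (0 <= c * x ^ S j / (1 - x))%R by lra.
    apply Rdiv_le_0_compat; [|lra].
    apply Rmult_le_pos; [exact Hc | apply pow_le; lra]. }
  pose proof (H j) as Hd.
  pose proof (Cmod_ge_0 (den j)); pose proof (Cmod_ge_0 (num (S j))).
  destruct m as [|[|m]].
  - simpl continuant; rewrite Cmod_1; nra.
  - simpl continuant; nra.
  - rewrite continuant_SS.
    eapply Rle_trans; [apply Cmod_triangle|]; rewrite !Cmod_mult.
    pose proof (IH (S m) ltac:(lia) (S j) ltac:(lia)) as I1.
    pose proof (IH m ltac:(lia) (S (S j)) ltac:(lia)) as I2.
    eapply Rle_trans; [|exact H1].
    (* The weight decreases with the index, so its value at [S j] bounds both shorter
       continuants. *)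
    apply Rle_trans with ((Cmod (den j) + Cmod (num (S j)))
                          * exp (c * x ^ S j / (1 - x)))%R.
    + rewrite Rmult_plus_distr_r; apply Rplus_le_compat;
        apply Rmult_le_compat_l; lra.
    + apply Rmult_le_compat_r; lra.
Qed.

(** * Convergence criterion for continued fractions *)

Lemma Cdiv_lim (u v : nat -> C) (u0 v0 : C) :
  v0 <> 0 ->
  is_lim_seq (fun n => Cmod (u n - u0)) 0 ->
  is_lim_seq (fun n => Cmod (v n - v0)) 0 ->
  forall eps : posreal,
    eventually (fun n => v n <> 0 /\ (Cmod (u n / v n - u0 / v0) < eps)%R).
Proof.
  intros Hv0 Hu Hv eps.
  pose proof (proj1 (Cmod_gt_0 v0) Hv0) as Hp.
  (* [K] bounds [1 / |v n * v0|] as soon as [|v n|] exceeds [|v0| / 2]. *)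
  pose (K := (2 / (Cmod v0 * Cmod v0))%R).
  assert (Hlim : is_lim_seq (fun n => K * (Cmod v0 * Cmod (u n - u0)
                 + Cmod u0 * Cmod (v n - v0)))%R 0).
  { replace (Finite 0) with (Finite (K * (Cmod v0 * 0 + Cmod u0 * 0)))
      by (f_equal; ring).
    apply (is_lim_seq_scal_l _ K (Finite _)), is_lim_seq_plus';
      [apply (is_lim_seq_scal_l _ _ (Finite 0)), Hu
      |apply (is_lim_seq_scal_l _ _ (Finite 0)), Hv]. }
  apply is_lim_seq_spec in Hlim, Hv.
  assert (Hh : (0 < Cmod v0 / 2)%R) by lra.
  specialize (Hlim eps); specialize (Hv (mkposreal _ Hh)); simpl in Hv.
  generalize (filter_and _ _ Hlim Hv); apply filter_imp; intros n [H1 H2].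
  rewrite Rminus_0_r in H1, H2.
  rewrite Rabs_pos_eq in H2 by apply Cmod_ge_0.
  assert (Hvn : (Cmod v0 / 2 < Cmod (v n))%R).
  { pose proof (Cmod_triangle (v n) (- (v n - v0))) as Ht.
    rewrite Cmod_opp in Ht.
    replace (v n + - (v n - v0)) with v0 in Ht by ring. lra. }
  assert (Hn : v n <> 0) by (apply Cmod_gt_0; lra).
  split; [exact Hn|].
  eapply Rle_lt_trans; [|exact H1].
  eapply Rle_trans; [|apply Rle_abs].
  replace (u n / v n - u0 / v0)
    with ((v0 * (u n - u0) + - (u0 * (v n - v0))) / (v n * v0))
    by (field; now split).
  rewrite Cmod_div by now apply Cmult_neq_0.
  rewrite Rmult_comm; unfold Rdiv; apply Rmult_le_compat.
  - apply Cmod_ge_0.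
  - apply Rlt_le, Rinv_0_lt_compat, Cmod_gt_0; now apply Cmult_neq_0.
  - eapply Rle_trans; [apply Cmod_triangle|]; rewrite Cmod_opp, !Cmod_mult; lra.
  - replace K with (/ (Cmod v0 / 2 * Cmod v0))%R by (unfold K; field; lra).
    rewrite Cmod_mult; apply Rinv_le_contravar; nra.
Qed.

Lemma Cmod_lim_0_of_le (u : nat -> C) M x :
  (0 < x < 1)%R -> (forall n, (Cmod (u n) <= M * x ^ n)%R) ->
  is_lim_seq (fun n => Cmod (u n)) 0.
Proof.
  intros Hx H.
  apply is_lim_seq_le_le with (u := fun _ => 0%R) (w := fun n => (M * x ^ n)%R).
  - intro n; split; [apply Cmod_ge_0 | apply H].
  - apply is_lim_seq_const.
  - replace (Finite 0) with (Finite (M * 0)) by (f_equal; ring).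
    apply (is_lim_seq_scal_l _ M (Finite 0)), is_lim_seq_geom.
    rewrite Rabs_pos_eq; lra.
Qed.

(** A criterion in the spirit of Pincherle: a bounded solution of the three-term recurrence
    determines the value, because geometric decay of the partial numerators kills the second term in
    the expansions of [F 0] and [F 1]. *)
Lemma cf_has_value_of_bounded_solution (num den : nat -> C) (F : nat -> C) c x M :
  (0 <= c)%R -> (0 < x < 1)%R ->
  (forall j, num (S j) <> 0) ->
  (forall j, (Cmod (den j) <= 1 + c * x ^ j)%R) ->
  (forall j, (Cmod (num (S j)) <= c * x ^ j)%R) ->
  (forall j, F j = den j * F (S j) + num (S j) * F (S (S j))) ->
  (forall j, (Cmod (F j) <= M)%R) ->
  F 1%nat <> 0 ->
  cf_has_value num den (Some (F 0%nat / F 1%nat)).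
Proof.
  intros Hc Hx Hnum Hden Hn HF HM HF1.
  assert (Hx' : forall j, (0 < x ^ j)%R) by (intro; apply pow_lt; lra).
  destruct (Rle_lt_dec 0 M) as [HM0|HM0];
    [|pose proof (Cmod_ge_0 (F 0%nat)); specialize (HM 0%nat); lra].
  assert (Hsum : forall j,
    (Cmod (den j) + Cmod (num (S j)) <= 1 + 2 * c * x ^ j)%R)
    by (intro j; specialize (Hden j); specialize (Hn j); lra).
  (* The constant is [2 * c] because denominator and numerator each contribute [c * x ^ j]; index 0
     has the largest weight. *)
  pose (E := exp (2 * c * x ^ 0 / (1 - x))).
  assert (HE : forall k n, (Cmod (continuant num den k n) <= E)%R).
  { intros k n; eapply Rle_trans; [apply (continuant_bound _ _ (2 * c) x); trivial; lra|].
    apply (exp_geom_decr (2 * c) x 0 k); trivial; lra. }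
  assert (Herr : forall k m n,
    (Cmod (num (S (S n)) * continuant num den k m * F (S (S (S n))))
     <= c * E * M * x ^ n)%R).
  { intros k m n; rewrite !Cmod_mult.
    replace (c * E * M * x ^ n)%R with (c * x ^ n * E * M)%R by ring.
    repeat apply Rmult_le_compat; trivial; try apply Cmod_ge_0;
      try (apply Rmult_le_pos; apply Cmod_ge_0).
    eapply Rle_trans; [apply Hn|]; apply Rmult_le_compat_l; [exact Hc|].
    simpl; specialize (Hx' n); nra. }
  intros P [eps HP]; unfold filtermap.
  (* Numerator and denominator are kept multiplied by [F (S (S n))]: only these products are known
     to converge. Since the limit [F 1] is nonzero, the second product is eventually nonzero, hence
     so are both of its factors. *)
  assert (Hev : eventually (fun n =>
     continuant num den 1 (S n) * F (S (S n)) <> 0 /\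
     (Cmod (continuant num den 0 (S (S n)) * F (S (S n))
            / (continuant num den 1 (S n) * F (S (S n)))
            - F 0%nat / F 1%nat) < eps)%R)).
  { apply (Cdiv_lim (fun n => continuant num den 0 (S (S n)) * F (S (S n)))
                    (fun n => continuant num den 1 (S n) * F (S (S n))));
      [exact HF1| |].
    - apply Cmod_lim_0_of_le with (c * E * M)%R x; [exact Hx|]; intro n.
      rewrite (continuant_recurrence num den F 0 (S n) HF).
      cbn [Nat.add].
      match goal with |- (Cmod ?z <= _)%R => replace z with
        (- (num (S (S n)) * continuant num den 0 (S n) * F (S (S (S n))))) by ring end.
      rewrite Cmod_opp; apply Herr.
    - apply Cmod_lim_0_of_le with (c * E * M)%R x; [exact Hx|]; intro n.
      rewrite (continuant_recurrence num den F 1 n HF).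
      cbn [Nat.add].
      match goal with |- (Cmod ?z <= _)%R => replace z with
        (- (num (S (S n)) * continuant num den 1 n * F (S (S (S n))))) by ring end.
      rewrite Cmod_opp; apply Herr. }
  (* Approximant [S n] pairs with expansions of length [S n] for [F 0] and [n] for [F 1]; hence the
     shift of the threshold. *)
  destruct Hev as [N HN]; exists (S N); intros [|n] Hle; [lia|].
  destruct (HN n ltac:(lia)) as [H1 H2].
  unfold cf_approximant; rewrite cf_from_continuant by exact Hnum.
  destruct Ceq_dec as [Z|Z]; [destruct H1; rewrite Z; ring|].
  apply HP, C_NormedModule_mixin_compat1.
  replace (continuant num den 0 (S (S n)) / continuant num den 1 (S n))
    with (continuant num den 0 (S (S n)) * F (S (S n))
          / (continuant num den 1 (S n) * F (S (S n)))); [exact H2|].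
  field; split; [exact Z | intro Z'; apply H1; rewrite Z'; ring].
Qed.

(** * Finite products and their bounds *)

Lemma Cprod_neq_0 (f : nat -> C) n :
  (forall j, f j <> 0) -> Cprod f n <> 0.
Proof.
  intro H; induction n as [|n IH]; simpl; [exact C1_nz | now apply Cmult_neq_0].
Qed.

Lemma Cprod_ext (f g : nat -> C) n :
  (forall j, f j = g j) -> Cprod f n = Cprod g n.
Proof. intro H; induction n as [|n IH]; simpl; [|rewrite IH, H]; reflexivity. Qed.

Lemma Cprod_scal (c : C) (f : nat -> C) n :
  Cprod (fun j => c * f j) n = c ^ n * Cprod f n.
Proof. induction n as [|n IH]; simpl; [|rewrite IH]; ring. Qed.

Lemma Cprod_inv (f : nat -> C) n :
  (forall j, f j <> 0) -> / Cprod f n = Cprod (fun j => / f j) n.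
Proof.
  intro H; induction n as [|n IH]; simpl; [field; exact C1_nz|].
  rewrite <- IH; field; split; [apply H | now apply Cprod_neq_0].
Qed.

Lemma Cmod_Cprod_le_pow (f : nat -> C) K n :
  (forall j, (Cmod (f j) <= K)%R) -> (Cmod (Cprod f n) <= K ^ n)%R.
Proof.
  intro H; induction n as [|n IH]; simpl; [rewrite Cmod_1; lra|].
  rewrite Cmod_mult, Rmult_comm.
  apply Rmult_le_compat; trivial; apply Cmod_ge_0.
Qed.

Lemma bounded_of_eventually_bounded (u : nat -> R) M N :
  (forall n, (N <= n)%nat -> (u n <= M)%R) -> exists M', forall n, (u n <= M')%R.
Proof.
  revert M; induction N as [|N IH]; intros M H.
  - exists M; intro n; apply H; lia.
  - apply (IH (Rmax M (u N))); intros n Hn.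
    destruct (Nat.eq_dec n N) as [->|]; [apply Rmax_r|].
    eapply Rle_trans; [apply H; lia | apply Rmax_l].
Qed.

(** From [N] on, the modulus of the product times the weight [exp (c * x ^ n / (1 - x))] never
    increases, and the weight is at least 1; the finitely many earlier products are bounded
    anyway. *)
Lemma Cprod_bounded (f : nat -> C) c x N :
  (0 <= c)%R -> (0 < x < 1)%R ->
  (forall j, (N <= j)%nat -> (Cmod (f j) <= 1 + c * x ^ j)%R) ->
  exists M, forall n, (Cmod (Cprod f n) <= M)%R.
Proof.
  intros Hc Hx H.
  apply (bounded_of_eventually_bounded _
           (Cmod (Cprod f N) * exp (c * x ^ N / (1 - x))) N).
  assert (H' : forall n, (Cmod (Cprod f (N + n)) * exp (c * x ^ (N + n) / (1 - x))
             <= Cmod (Cprod f N) * exp (c * x ^ N / (1 - x)))%R).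
  { induction n as [|n IH]; [rewrite Nat.add_0_r; lra|].
    eapply Rle_trans; [|exact IH].
    rewrite Nat.add_succ_r; simpl Cprod; rewrite Cmod_mult, Rmult_assoc.
    apply Rmult_le_compat_l; [apply Cmod_ge_0|].
    eapply Rle_trans; [|apply (exp_geom_step c x (N + n) Hc Hx)].
    apply Rmult_le_compat_r; [apply Rlt_le, exp_pos | apply H; lia]. }
  intros n Hn; specialize (H' (n - N)%nat).
  replace (N + (n - N))%nat with n in H' by lia.
  eapply Rle_trans; [|exact H'].
  rewrite <- (Rmult_1_r (Cmod (Cprod f n))) at 1.
  apply Rmult_le_compat_l; [apply Cmod_ge_0|].
  eapply Rle_trans; [|apply exp_ineq1_le].
  enough (0 <= c * x ^ n / (1 - x))%R by lra.
  apply Rdiv_le_0_compat; [|lra].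
  apply Rmult_le_pos; [exact Hc | apply pow_le; lra].
Qed.

(** * Dominated and telescoping complex series *)

Lemma CSeries_unique (u : nat -> C) (l : C) :
  is_series (V := C_NormedModule) u l -> CSeries u = l.
Proof.
  intro H; apply (iota_unique (V := C_CompleteNormedModule)); [|exact H].
  intros y Hy; exact (filterlim_locally_unique (V := C_NormedModule) _ _ _ Hy H).
Qed.

(** A summable majorant rules out the unspecified case of [CSeries]. *)
Lemma CSeries_correct (u : nat -> C) (v : nat -> R) :
  (forall n, (Cmod (u n) <= v n)%R) -> ex_series v ->
  is_series (V := C_NormedModule) u (CSeries u).
Proof.
  intros Huv Hv.
  destruct (ex_series_le (V := C_CompleteNormedModule) u v Huv Hv) as [l Hl].
  now rewrite (CSeries_unique u l Hl).
Qed.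

Lemma Cmod_CSeries_le (u : nat -> C) (v : nat -> R) :
  (forall n, (Cmod (u n) <= v n)%R) -> ex_series v ->
  (Cmod (CSeries u) <= Series v)%R.
Proof.
  intros Huv Hv.
  pose proof (CSeries_correct u v Huv Hv) as Hu.
  apply (filterlim_le (F := eventually)
           (fun n => norm (sum_n (u : nat -> C_NormedModule) n)) (sum_n v)
           (Finite (Cmod (CSeries u))) (Finite (Series v))).
  - apply filter_forall; intro n.
    induction n as [|n IH].
    + rewrite !sum_O; apply Huv.
    + rewrite !sum_Sn; eapply Rle_trans; [apply norm_triangle|].
      apply Rplus_le_compat; [exact IH | apply Huv].
  - eapply filterlim_comp;
      [exact Hu | apply (filterlim_norm (V := C_NormedModule) (CSeries u))].
  - exact (Series_correct v Hv).
Qed.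

Lemma is_series_telescope (w : nat -> C) :
  w 0%nat = 0 -> is_lim_seq (fun n => Cmod (w n)) 0 ->
  is_series (V := C_NormedModule) (fun n => w n - w (S n)) (RtoC 0).
Proof.
  intros H0 Hw.
  assert (Hs : forall n, @eq C (sum_n (G := C_NormedModule) (fun n => w n - w (S n)) n)
                              (- w (S n))).
  { induction n as [|n IH]; [rewrite sum_O, H0; ring|].
    rewrite sum_Sn, IH; change (@plus C_NormedModule) with Cplus; ring. }
  apply is_lim_seq_incr_1, is_lim_seq_spec in Hw.
  intros P [eps HP]; destruct (Hw eps) as [N HN].
  exists N; intros n Hn; apply HP, C_NormedModule_mixin_compat1.
  rewrite Hs; specialize (HN n Hn); simpl in HN.
  rewrite Rminus_0_r, Rabs_pos_eq in HN by apply Cmod_ge_0.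
  change (Cmod (- w (S n) - 0) < eps)%R.
  replace (- w (S n) - 0) with (- w (S n)) by ring; now rewrite Cmod_opp.
Qed.

(** * Terms of the tails and their termwise recurrence *)

(** Summed over [n], the terms for [m = 2 k] and [m = 2 k + 1] give
    [G (a q^m) (b q^k) (lam q^m) / ((1 + b q) ... (1 + b q^k))]; the
    denominators normalise these values so that they satisfy the three-term
    recurrence without further factors. *)
Definition tail_term (q a b lam : C) (m n : nat) : C :=
  q ^ ((n ^ 2 + n) / 2) * q ^ (m * n) * Cprod (fun j => a + lam * q ^ j) n
  / (Cprod (fun j => 1 - q ^ S j) n
     * Cprod (fun j => 1 + b * q ^ S j) (n + m / 2)).

Lemma triangular_S n : ((S n ^ 2 + S n) / 2 = S n + (n ^ 2 + n) / 2)%nat.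
Proof.
  replace (S n ^ 2 + S n)%nat with (S n * 2 + (n ^ 2 + n))%nat by (simpl; lia).
  now rewrite Nat.div_add_l by lia.
Qed.

(** A partial theta series: the ratio of consecutive terms is [r * K * r ^ n], which tends to 0
    however large [K] is. *)
Lemma ex_series_theta r K :
  (0 < r < 1)%R -> (0 < K)%R ->
  ex_series (fun n => r ^ ((n ^ 2 + n) / 2) * K ^ n)%R.
Proof.
  intros Hr HK.
  assert (Hpos : forall n, (0 < r ^ ((n ^ 2 + n) / 2) * K ^ n)%R)
    by (intro n; apply Rmult_lt_0_compat; apply pow_lt; lra).
  apply ex_series_ext
    with (a := fun n => Rabs (r ^ ((n ^ 2 + n) / 2) * K ^ n)).
  { intro n; apply Rabs_pos_eq, Rlt_le, Hpos. }
  apply ex_series_DAlembert with 0%R; [lra | intro n; apply Rgt_not_eq, Hpos |].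
  apply is_lim_seq_ext with (fun n => r * K * r ^ n)%R.
  - intro n; rewrite triangular_S, pow_add, <- !tech_pow_Rmult.
    replace (r * r ^ n * r ^ ((n ^ 2 + n) / 2) * (K * K ^ n)
             / (r ^ ((n ^ 2 + n) / 2) * K ^ n))%R with (r * K * r ^ n)%R
      by (field; split; apply pow_nonzero; lra).
    symmetry; apply Rabs_pos_eq.
    pose proof (pow_lt r n (proj1 Hr)); apply Rmult_le_pos; nra.
  - replace (Finite 0) with (Finite (r * K * 0)) by (f_equal; ring).
    apply (is_lim_seq_scal_l _ _ (Finite 0)), is_lim_seq_geom.
    rewrite Rabs_pos_eq; lra.
Qed.

Section Tails.

Variables q a b lam : C.
Hypothesis Hq : (Cmod q < 1)%R.
Hypothesis Hq0 : q <> 0.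
Hypothesis Hb : forall n, 1 + b * q ^ S n <> 0.

Lemma one_minus_pow_neq_0 n : 1 - q ^ S n <> 0.
Proof.
  intro E.
  assert (H : q ^ S n = 1) by (rewrite <- (Cplus_0_r (q ^ S n)), <- E; ring).
  apply (f_equal Cmod) in H; rewrite Cmod_pow, Cmod_1 in H.
  pose proof (pow_lt_1_compat (Cmod q) (S n)
                (conj (Cmod_ge_0 q) Hq) ltac:(lia)); lra.
Qed.

Lemma tail_term_0_G n : tail_term q a b lam 0 n = G_term q a b lam n.
Proof.
  unfold tail_term, G_term; simpl (0 * n)%nat; simpl (0 / 2)%nat.
  rewrite Nat.add_0_r; simpl (q ^ 0); now rewrite Cmult_1_r.
Qed.

(** The extra [q ^ n] is distributed over the [n] factors [a + lam * q ^ j], which scales [a] and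
    [lam] by [q]. *)
Lemma tail_term_1_G n :
  tail_term q a b lam 1 n = G_term q (a * q) b (lam * q) n.
Proof.
  unfold tail_term, G_term; rewrite Nat.mul_1_l; simpl (1 / 2)%nat.
  rewrite Nat.add_0_r.
  rewrite (Cprod_ext (fun j => a * q + lam * q * q ^ j)
             (fun j => q * (a + lam * q ^ j))) by (intro; ring).
  rewrite Cprod_scal; f_equal; ring.
Qed.

(** The factor [1 - q ^ S n] stays on the left because the telescoping difference contains exactly
    this product. *)
Lemma tail_term_S m n :
  (1 - q ^ S n) * tail_term q a b lam m (S n)
  = q ^ S n * q ^ m * (a + lam * q ^ n) / (1 + b * q ^ S (n + m / 2))
    * tail_term q a b lam m n.
Proof.
  unfold tail_term; rewrite triangular_S, Nat.mul_succ_r, !Cpow_add_r.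
  rewrite Nat.add_succ_l; simpl Cprod.
  pose proof (Cprod_neq_0 (fun j => 1 - q ^ S j) n one_minus_pow_neq_0).
  pose proof (Cprod_neq_0 (fun j => 1 + b * q ^ S j) (n + m / 2) Hb).
  pose proof (one_minus_pow_neq_0 n); pose proof (Hb (n + m / 2)%nat).
  simpl Cprod in *.
  set (d := Cprod (fun j => 1 - q * q ^ j) n) in *.
  set (e := Cprod (fun j => 1 + b * (q * q ^ j)) (n + m / 2)) in *.
  simpl Cpow in *; field; tauto.
Qed.

Lemma tail_term_SS m n :
  tail_term q a b lam (S (S m)) n
  = q ^ n * q ^ n / (1 + b * q ^ S (n + m / 2)) * tail_term q a b lam m n.
Proof.
  unfold tail_term.
  replace (S (S m) / 2)%nat with (S (m / 2))
    by (change (S (S m)) with (1 * 2 + m)%nat; now rewrite Nat.div_add_l by lia).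
  rewrite Nat.add_succ_r; simpl (S (S m) * n)%nat; rewrite !Cpow_add_r; simpl Cprod.
  pose proof (Cprod_neq_0 (fun j => 1 - q ^ S j) n one_minus_pow_neq_0).
  pose proof (Cprod_neq_0 (fun j => 1 + b * q ^ S j) (n + m / 2) Hb).
  pose proof (Hb (n + m / 2)%nat).
  simpl Cprod in *.
  set (d := Cprod (fun j => 1 - q * q ^ j) n) in *.
  set (e := Cprod (fun j => 1 + b * (q * q ^ j)) (n + m / 2)) in *.
  simpl Cpow in *; field; tauto.
Qed.

(** Passing from [2 * k] to its successor leaves [m / 2] unchanged, so no factor in [b] appears; it
    enters at the following odd step. *)
Lemma tail_term_S_even k n :
  tail_term q a b lam (S (2 * k)) n = q ^ n * tail_term q a b lam (2 * k) n.
Proof.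
  unfold tail_term.
  replace (S (2 * k) / 2)%nat with (2 * k / 2)%nat
    by (rewrite (Nat.mul_comm 2 k), Nat.div_mul by lia;
        apply Nat.div_unique with 1%nat; lia).
  rewrite (Nat.mul_succ_l (2 * k) n), Cpow_add_r; unfold Cdiv; ring.
Qed.

Lemma tail_term_S_odd k n :
  tail_term q a b lam (S (S (2 * k))) n
  = q ^ n / (1 + b * q ^ S (n + k)) * tail_term q a b lam (S (2 * k)) n.
Proof.
  rewrite tail_term_SS, tail_term_S_even, (Nat.mul_comm 2 k), Nat.div_mul by lia.
  unfold Cdiv; ring.
Qed.

Lemma partial_num_odd k :
  partial_num q a b lam (S (2 * k))
  = lam * q ^ S (2 * k) - a * b * q ^ (3 * k + 2).
Proof.
  unfold partial_num.
  replace ((S (2 * k) + 1) / 2)%nat with (S k)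
    by (apply Nat.div_unique with 0%nat; lia).
  replace (Nat.odd (S (2 * k))) with true
    by (symmetry; apply Nat.odd_spec; exists k; lia).
  replace (2 * S k - 1)%nat with (S (2 * k)) by lia.
  now replace (3 * S k - 1)%nat with (3 * k + 2)%nat by lia.
Qed.

Lemma partial_num_even k :
  partial_num q a b lam (S (S (2 * k)))
  = b * q ^ S k + lam * q ^ S (S (2 * k)).
Proof.
  unfold partial_num.
  replace ((S (S (2 * k)) + 1) / 2)%nat with (S k)
    by (apply Nat.div_unique with 1%nat; lia).
  replace (Nat.odd (S (S (2 * k)))) with false
    by (symmetry; rewrite Nat.odd_succ, Nat.even_succ;
        rewrite <- Nat.negb_even, Nat.even_mul; reflexivity).
  now replace (2 * S k)%nat with (S (S (2 * k))) by lia.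
Qed.

(** The right-hand side telescopes when summed over [n]. *)
Lemma tail_term_recurrence m n :
  tail_term q a b lam m n
  - (partial_den q a m * tail_term q a b lam (S m) n
     + partial_num q a b lam (S m) * tail_term q a b lam (S (S m)) n)
  = (1 - q ^ n) * tail_term q a b lam m n
    - (1 - q ^ S n) * tail_term q a b lam m (S n).
Proof.
  rewrite tail_term_S; unfold partial_den.
  (* The parity of [m] selects the partial numerator. In each case all terms become multiples of one
     [t], leaving a rational identity in [q], [q ^ n] and [q ^ k] whose only denominator is
     [1 + b * q ^ S (n + k)]. *)
  destruct (Nat.Even_or_Odd m) as [[k Hk]|[k Hk]].
  - subst m; rewrite tail_term_SS, tail_term_S_even, partial_num_odd.
    rewrite (Nat.mul_comm 2 k), Nat.div_mul by lia.
    pose proof (Hb (n + k)%nat) as H.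
    replace (3 * k + 2)%nat with (k + k + k + 2)%nat by lia.
    replace (k * 2)%nat with (k + k)%nat in * by lia.
    set (t := tail_term q a b lam (k + k) n) in *; clearbody t.
    simpl Cpow in *; rewrite ?Cpow_add_r in *; simpl Cpow in *.
    field; exact H.
  - replace m with (S (2 * k)) by lia.
    rewrite (tail_term_SS (S (2 * k))), tail_term_S_odd, partial_num_even.
    replace (S (2 * k) / 2)%nat with k
      by (apply Nat.div_unique with 1%nat; lia).
    pose proof (Hb (n + k)%nat) as H.
    replace (2 * k)%nat with (k + k)%nat in * by lia.
    set (t := tail_term q a b lam (S (k + k)) n) in *; clearbody t.
    simpl Cpow in *; rewrite ?Cpow_add_r in *; simpl Cpow in *.
    rewrite ?Cpow_add_r in *; field; exact H.
Qed.

(** * A summable majorant uniform in the tail index *)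

Lemma inverse_denominators_bounded :
  exists E, forall N, (Cmod (/ Cprod (fun j => 1 + b * q ^ S j) N)%C <= E)%R.
Proof.
  pose proof (proj1 (Cmod_gt_0 q) Hq0) as Hr.
  assert (Hlim : is_lim_seq (fun n => Cmod b * Cmod q ^ n)%R 0).
  { replace (Finite 0) with (Finite (Cmod b * 0)) by (f_equal; ring).
    apply (is_lim_seq_scal_l _ _ (Finite 0)), is_lim_seq_geom.
    rewrite Rabs_pos_eq; lra. }
  apply is_lim_seq_spec in Hlim.
  (* For [0 <= y <= 1/2] one has [1 / (1 - y) <= 1 + 2 * y]; this explains both the threshold and
     the constant [2 * Cmod b]. *)
  destruct (Hlim (mkposreal (1 / 2) ltac:(lra))) as [N HN]; simpl in HN.
  destruct (Cprod_bounded (fun j => / (1 + b * q ^ S j)) (2 * Cmod b) (Cmod q) N)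
    as [M HM].
  - pose proof (Cmod_ge_0 b); lra.
  - lra.
  - intros j Hj; specialize (HN j Hj).
    pose proof (pow_lt (Cmod q) j Hr) as Hp; pose proof (Cmod_ge_0 b).
    rewrite Rminus_0_r, Rabs_pos_eq in HN by nra.
    set (y := (Cmod b * Cmod q ^ j)%R) in *.
    assert (Hy : (0 <= y)%R) by (unfold y; nra).
    assert (Hd : (1 - y <= Cmod (1 + b * q ^ S j))%R).
    { pose proof (Cmod_triangle (1 + b * q ^ S j) (- (b * q ^ S j))) as Ht.
      replace (1 + b * q ^ S j + - (b * q ^ S j)) with (RtoC 1) in Ht by ring.
      rewrite Cmod_opp, Cmod_1, Cmod_mult, Cmod_pow in Ht.
      enough (Cmod b * Cmod q ^ S j <= y)%R by lra.
      unfold y; simpl; apply Rmult_le_compat_l; nra. }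
    rewrite Cmod_inv by apply Hb.
    apply Rle_trans with (/ (1 - y))%R; [apply Rinv_le_contravar; lra|].
    rewrite Rmult_assoc; fold y.
    apply Rmult_le_reg_r with (1 - y)%R; [lra|].
    rewrite Rinv_l by lra; nra.
  - exists M; intro n; rewrite Cprod_inv by exact Hb; apply HM.
Qed.

(** The bound is free of [m]: [|q ^ (m * n)|] is at most 1, and [E] serves products of every length.
    The summand 1 keeps the base positive, as [ex_series_theta] demands, even if [a] and [lam]
    vanish. *)
Lemma Cmod_tail_term_le E m n :
  (forall N, (Cmod (/ Cprod (fun j => 1 + b * q ^ S j) N)%C <= E)%R) ->
  (Cmod (tail_term q a b lam m n)
   <= E * (Cmod q ^ ((n ^ 2 + n) / 2)
           * ((Cmod a + Cmod lam + 1) / (1 - Cmod q)) ^ n))%R.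
Proof.
  intro HE.
  pose proof (Cmod_ge_0 q) as Hr; pose proof (Cmod_ge_0 a); pose proof (Cmod_ge_0 lam).
  assert (Hpow : forall j, (0 <= Cmod q ^ j <= 1)%R).
  { intro j; split; [now apply pow_le|].
    rewrite <- (pow1 j); apply pow_incr; lra. }
  unfold tail_term, Cdiv.
  set (A := Cprod (fun j => 1 - q ^ S j) n).
  set (B := Cprod (fun j => 1 + b * q ^ S j) (n + m / 2)).
  replace (/ (A * B)) with (/ A * / B)
    by (field; split; apply Cprod_neq_0; trivial; exact one_minus_pow_neq_0).
  unfold A, B; clear A B; rewrite Cprod_inv by exact one_minus_pow_neq_0.
  rewrite !Cmod_mult, !Cmod_pow; unfold Rdiv; rewrite Rpow_mult_distr.
  assert (H1 : (Cmod (Cprod (fun j => a + lam * q ^ j) n)%C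
                <= (Cmod a + Cmod lam + 1) ^ n)%R).
  { apply Cmod_Cprod_le_pow; intro j.
    eapply Rle_trans; [apply Cmod_triangle|]; rewrite Cmod_mult, Cmod_pow.
    destruct (Hpow j); nra. }
  assert (H2 : (Cmod (Cprod (fun j => / (1 - q ^ S j)) n)%C
                <= (/ (1 - Cmod q)) ^ n)%R).
  { apply Cmod_Cprod_le_pow; intro j.
    rewrite Cmod_inv by apply one_minus_pow_neq_0.
    apply Rinv_le_contravar; [lra|].
    pose proof (Cmod_triangle (1 - q ^ S j) (q ^ S j)) as Ht.
    replace (1 - q ^ S j + q ^ S j) with (RtoC 1) in Ht by ring.
    rewrite Cmod_1, Cmod_pow, <- tech_pow_Rmult in Ht.
    destruct (Hpow j); nra. }
  specialize (HE (n + m / 2)%nat).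
  set (e := Cmod (/ Cprod (fun j => 1 + b * q ^ S j) (n + m / 2))) in *.
  assert (He : (0 <= e)%R) by apply Cmod_ge_0; clearbody e.
  set (x := Cmod (Cprod (fun j => a + lam * q ^ j) n)) in *.
  assert (Hx : (0 <= x)%R) by apply Cmod_ge_0; clearbody x.
  set (y := Cmod (Cprod (fun j => / (1 - q ^ S j)) n)) in *.
  assert (Hy : (0 <= y)%R) by apply Cmod_ge_0; clearbody y.
  pose proof (Hpow (m * n)%nat) as Hm; set (z := (Cmod q ^ (m * n))%R) in *.
  clearbody z.
  pose proof (Hpow ((n ^ 2 + n) / 2)%nat) as Ht.
  set (t := (Cmod q ^ ((n ^ 2 + n) / 2))%R) in *; clearbody t.
  replace (t * z * x * (y * e))%R with (e * (t * (z * x * y)))%R by ring.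
  assert (0 <= z * x * y)%R
    by (repeat apply Rmult_le_pos; trivial; apply Hm).
  apply Rmult_le_compat; trivial; [apply Rmult_le_pos; tauto|].
  apply Rmult_le_compat_l; [tauto|].
  apply Rmult_le_compat; trivial; [apply Rmult_le_pos; tauto|].
  nra.
Qed.

Lemma tail_term_majorant :
  exists v : nat -> R, ex_series v /\
    forall m n, (Cmod (tail_term q a b lam m n) <= v n)%R.
Proof.
  destruct inverse_denominators_bounded as [E HE].
  pose proof (proj1 (Cmod_gt_0 q) Hq0).
  pose proof (Cmod_ge_0 a); pose proof (Cmod_ge_0 lam).
  eexists; split; [|intros m n; apply (Cmod_tail_term_le E m n HE)].
  apply (ex_series_scal_l (V := R_NormedModule) E), ex_series_theta; [lra|].
  apply Rdiv_lt_0_compat; lra.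
Qed.

(** * The tails as a bounded solution of the three-term recurrence *)

Definition tail (m : nat) : C := CSeries (tail_term q a b lam m).

Lemma tail_0_G : tail 0 = G q a b lam.
Proof.
  unfold tail, G; f_equal; apply functional_extensionality.
  exact tail_term_0_G.
Qed.

Lemma tail_1_G : tail 1 = G q (a * q) b (lam * q).
Proof.
  unfold tail, G; f_equal; apply functional_extensionality.
  exact tail_term_1_G.
Qed.

Lemma tail_bounded : exists M, forall m, (Cmod (tail m) <= M)%R.
Proof.
  destruct tail_term_majorant as [v [Hv H]].
  exists (Series v); intro m; now apply Cmod_CSeries_le.
Qed.

Lemma tail_recurrence m :
  tail m = partial_den q a m * tail (S m)
           + partial_num q a b lam (S m) * tail (S (S m)).
Proof.
  destruct tail_term_majorant as [v [Hv H]].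
  assert (Hs : forall j, is_series (V := C_NormedModule)
                           (tail_term q a b lam j) (tail j))
    by (intro j; now apply CSeries_correct with v).
  assert (H1 := is_series_minus _ _ _ _ (Hs m)
    (is_series_plus _ _ _ _
       (is_series_scal (partial_den q a m) _ _ (Hs (S m)))
       (is_series_scal (partial_num q a b lam (S m)) _ _ (Hs (S (S m)))))).
  assert (H2 : is_series (V := C_NormedModule)
     (fun n => (1 - q ^ n) * tail_term q a b lam m n
               - (1 - q ^ S n) * tail_term q a b lam m (S n)) (RtoC 0)).
  (* The boundary term vanishes at [n = 0] thanks to [1 - q ^ 0], and tends to 0 because
     [|1 - q ^ n|] is at most 2 and the majorant is summable. *)
  { apply (is_series_telescope (fun n => (1 - q ^ n) * tail_term q a b lam m n)).
    - simpl; ring.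
    - apply is_lim_seq_le_le with (u := fun _ => 0%R) (w := fun n => (2 * v n)%R).
      + intro n; split; [apply Cmod_ge_0|]; rewrite Cmod_mult.
        apply Rmult_le_compat; try apply Cmod_ge_0; [|apply H].
        eapply Rle_trans; [apply Cmod_triangle|].
        rewrite Cmod_opp, Cmod_1, Cmod_pow.
        enough (Cmod q ^ n <= 1)%R by lra.
        rewrite <- (pow1 n); apply pow_incr; split; [apply Cmod_ge_0 | lra].
      + apply is_lim_seq_const.
      + replace (Finite 0) with (Finite (2 * 0)) by (f_equal; ring).
        now apply (is_lim_seq_scal_l _ _ (Finite 0)), ex_series_lim_0. }
  apply (is_series_ext _ _ _
           (fun n => eq_sym (tail_term_recurrence m n))) in H2.
  (* The same series has been summed twice, once by linearity and once by telescoping. *)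
  pose proof (filterlim_locally_unique (V := C_NormedModule) _ _ _ H1 H2) as E.
  change (tail m - (partial_den q a m * tail (S m)
           + partial_num q a b lam (S m) * tail (S (S m))) = 0) in E.
  rewrite <- (Cplus_0_r (_ + _)), <- E; ring.
Qed.

(** * Geometric decay of the coefficients, and the value of the continued fraction *)

(** The even partial numerators contain [b * q ^ n] at index [2 * n], so the decay per index is only
    that of the square root [x] of [|q|]. Every power [q ^ i] that occurs satisfies [k <= 2 * i]. *)
Lemma Cmod_partial_num_le x k :
  (0 <= x <= 1)%R -> Cmod q = (x * x)%R ->
  (Cmod (partial_num q a b lam (S k))
   <= (Cmod a * Cmod b + Cmod b + Cmod lam) * x ^ k)%R.
Proof.
  intros Hx Hqx.
  assert (Hp : forall i, (k <= 2 * i)%nat -> (Cmod (q ^ i) <= x ^ k)%R).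
  { intros i Hi; rewrite Cmod_pow, Hqx, Rpow_mult_distr.
    replace ((x ^ i * x ^ i)%R) with (x ^ k * x ^ (2 * i - k))%R.
    - rewrite <- (Rmult_1_r (x ^ k)) at 2.
      apply Rmult_le_compat_l; [apply pow_le; lra|].
      rewrite <- (pow1 (2 * i - k)); apply pow_incr; lra.
    - rewrite <- !pow_add; f_equal; lia. }
  pose proof (Cmod_ge_0 a) as Ha; pose proof (Cmod_ge_0 b) as Hb'.
  pose proof (Cmod_ge_0 lam) as Hl.
  pose proof (Rmult_le_pos _ _ Ha Hb') as Hab.
  assert (Hxk : (0 <= x ^ k)%R) by (apply pow_le; lra).
  pose proof (Rmult_le_pos _ _ Hb' Hxk); pose proof (Rmult_le_pos _ _ Hab Hxk).
  destruct (Nat.Even_or_Odd k) as [[i Hi]|[i Hi]].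
  - rewrite Hi at 1; rewrite partial_num_odd.
    eapply Rle_trans; [apply Cmod_triangle|]; rewrite Cmod_opp, !Cmod_mult.
    pose proof (Rmult_le_compat_l _ _ _ Hl (Hp (S (2 * i)) ltac:(lia))).
    pose proof (Rmult_le_compat_l _ _ _ Hab (Hp (3 * i + 2)%nat ltac:(lia))).
    lra.
  - rewrite Hi, Nat.add_1_r, partial_num_even, <- (Nat.add_1_r (2 * i)), <- Hi.
    eapply Rle_trans; [apply Cmod_triangle|]; rewrite !Cmod_mult.
    pose proof (Rmult_le_compat_l _ _ _ Hb' (Hp (S i) ltac:(lia))).
    pose proof (Rmult_le_compat_l _ _ _ Hl (Hp (S k) ltac:(lia))).
    lra.
Qed.

Lemma Cmod_partial_den_le k :
  (Cmod (partial_den q a k) <= 1 + Cmod a * Cmod q ^ k)%R.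
Proof.
  unfold partial_den.
  eapply Rle_trans; [apply Cmod_triangle|].
  rewrite Cmod_1, Cmod_mult, Cmod_pow, Nat.add_1_r.
  pose proof (Cmod_ge_0 a); pose proof (Cmod_ge_0 q).
  apply Rplus_le_compat_l, Rmult_le_compat_l; [trivial|].
  simpl; assert (0 <= Cmod q ^ k)%R by now apply pow_le.
  nra.
Qed.

End Tails.

Theorem corollary2p3 :
  forall a b lam q : C,
    (Cmod q < 1)%R ->
    (forall n : nat, (1 <= n)%nat -> 1 + b * q ^ n <> 0) ->
    G q (a * q) b (lam * q) <> 0 ->
    (forall k : nat, (1 <= k)%nat -> partial_num q a b lam k <> 0) ->
    cf_has_value (partial_num q a b lam) (partial_den q a)
      (Some (G q a b lam / G q (a * q) b (lam * q))).
Proof.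
  intros a b lam q Hq Hb HG Hnum.
  (* At [q = 0] the first partial numerator would vanish. *)
  assert (Hq0 : q <> 0).
  { intro E; apply (Hnum 1%nat); [lia|].
    change 1%nat with (S (2 * 0)); rewrite partial_num_odd, E; simpl; ring. }
  assert (Hb' : forall n, 1 + b * q ^ S n <> 0) by (intro n; apply Hb; lia).
  destruct (tail_bounded q a b lam Hq Hq0 Hb') as [M HM].
  rewrite <- tail_1_G in HG |- *; rewrite <- tail_0_G.
  pose proof (proj1 (Cmod_gt_0 q) Hq0) as Hr.
  pose (x := sqrt (Cmod q)).
  assert (Hqx : Cmod q = (x * x)%R) by (symmetry; apply sqrt_sqrt; lra).
  assert (Hx : (0 < x < 1)%R).
  { split; [now apply sqrt_lt_R0|].
    rewrite <- sqrt_1; apply sqrt_lt_1; lra. }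
  pose proof (Cmod_ge_0 a); pose proof (Cmod_ge_0 b); pose proof (Cmod_ge_0 lam).
  assert (0 <= Cmod a * Cmod b)%R by nra.
  assert (Hxk : forall j, (0 <= x ^ j)%R) by (intro; apply pow_le; lra).
  apply cf_has_value_of_bounded_solution
    with (c := (Cmod a + (Cmod a * Cmod b + Cmod b + Cmod lam))%R) (x := x) (M := M);
    trivial.
  - lra.
  - intro j; apply Hnum; lia.
  - intro j; eapply Rle_trans; [apply Cmod_partial_den_le, Hq|].
    (* Here [|q| = x * x <= x], so the denominators decay at least at the slower rate needed for the
       numerators. *)
    assert (Hj : (Cmod q ^ j <= x ^ j)%R) by (apply pow_incr; nra).
    apply Rplus_le_compat_l, Rmult_le_compat; trivial; [apply pow_le|]; lra.
  - intro j; eapply Rle_trans; [apply (Cmod_partial_num_le q a b lam x); [lra|exact Hqx]|].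
    apply Rmult_le_compat_r; trivial; lra.
  - intro j; now apply tail_recurrence.
Qed.
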